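(* Let $ABC$ be an (ordinary, nondegenerate) triangle in the extended Euclidean plane. For any point $P$ not on the extended sides of either $ABC$ or its anticomplementary triangle $K^{-1}(ABC)$, the generalized circumcenter $O$ and the generalized orthocenter $H$ of $P$ with respect to $ABC$ exist, and they are given by $$O=T_{P'}^{-1}K(Q),\qquad H=K^{-1}T_{P'}^{-1}K(Q),$$ where $P'$ is the isotomic conjugate of $P$ with respect to $ABC$, $Q=K(P')$, and $T_{P'}$ is the affine map taking $ABC$ to the cevian triangle $D_3E_3F_3$ of the point $P'$.
   Context: The extended Euclidean plane is the Euclidean plane together with its line at infinity; $P$ may be an ordinary point or a point at infinity. Affine maps are extended to the line at infinity in the usual way. Products of maps denote composition (rightmost map applied first). $D_0,E_0,F_0$ are the midpoints of $BC,CA,AB$. $K$ is the complement map of $ABC$: the homothety with center the centroid of $ABC$ and ratio $-1/2$, so $K(A)=D_0$, $K(B)=E_0$, $K(C)=F_0$. The anticomplementary triangle of $ABC$ is $K^{-1}(ABC)$. The cevian triangle $DEF$ of $P$ has vertices $D=AP\cdot BC$, $E=BP\cdot CA$, $F=CP\cdot AB$ (a dot denotes intersection of lines). Under the hypotheses on $P$ these are ordinary points. The isotomic conjugate $P'$ of $P$ is the common point of the lines $AD_3,BE_3,CF_3$, where $D_3,E_3,F_3$ are the reflections of $D,E,F$ in $D_0,E_0,F_0$; thus $D_3E_3F_3$ is the cevian triangle of $P'$, and $T_{P'}(A)=D_3$, $T_{P'}(B)=E_3$, $T_{P'}(C)=F_3$. The point $Q=K(P')$ is the isotomcomplement of $P$.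 Definition. The generalized circumcenter of $P$ with respect to $ABC$ is the point $O$ for which $OD_0\parallel QD$, $OE_0\parallel QE$, $OF_0\parallel QF$. The generalized orthocenter of $P$ with respect to $ABC$ is the point $H$ for which $HA\parallel QD$, $HB\parallel QE$, $HC\parallel QF$. Here a condition such as $OD_0\parallel QD$ means that $O$ lies on the line through $D_0$ parallel to (or coinciding with) the line $QD$, and similarly for the others; in particular $O$ may equal $D_0$, and $H$ may equal $A$. If $Q$ is a point at infinity, the line through a point $X$ parallel to $QD$ is the line $XQ$. *)

(* Defs.v *)
From mathcomp Require Import all_boot all_order all_algebra reals.

Set Implicit Arguments.
Unset Strict Implicit.
Unset Printing Implicit Defensive.

Import GRing.Theory.
Local Open Scope ring_scope.

(* The extended plane is the projective plane of R^3: points are the subspaces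
   of dimension 1 and lines those of dimension 2, so that the line joining two
   points is their sum, the common point of lines is their intersection, and
   incidence is inclusion.  The ordinary point X of R^2 is spanned by (X, 1),
   and the line at infinity is the set of vectors with last coordinate 0. *)
Definition subspace (R : realType) := {vspace 'rV[R]_(2 + 1)}.

Section ExtendedPlane.
Variable R : realType.
Implicit Types (X Y : 'rV[R]_2) (U L : subspace R).

Definition is_point U : bool := \dim U == 1%N.

Definition ord_pt X : subspace R := <[row_mx X 1%:M]>%VS.

Definition line_at_infinity : subspace R :=
  lker (linfun (@rsubmx R 1 2 1)).

Definition line_through U V : subspace R := (U + V)%VS.

Definition on_line U L : bool := (U <= L)%VS.

(* Lines are parallel (or equal) when they have the same point at infinity;
   if the point at infinity of L is Q, this is the line joining U and Q. *)
Definition parallel_through U L : subspace R :=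
  line_through U (L :&: line_at_infinity)%VS.

(* The affine map X |-> X *m aff_lin + aff_trans. *)
Record affine_map := AffineMap { aff_lin : 'M[R]_2; aff_trans : 'rV[R]_2 }.
Implicit Types T : affine_map.

Definition aff_app T X : 'rV[R]_2 := X *m aff_lin T + aff_trans T.

Definition aff_invertible T : bool := aff_lin T \in unitmx.

(* This is the inverse map only if T is invertible. *)
Definition aff_inv T : affine_map :=
  AffineMap (invmx (aff_lin T)) (- (aff_trans T *m invmx (aff_lin T))).

(* Row vectors: (X, w) |-> (X *m aff_lin T + w *: aff_trans T, w). *)
Definition aff_ext T U : subspace R :=
  (linfun (mulmxr (block_mx (aff_lin T) 0 (aff_trans T) 1%:M)) @: U)%VS.

(* X |-> G + k *: (X - G) *)
Definition homothety (G : 'rV[R]_2) (k : R) : affine_map :=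
  AffineMap k%:M ((1 - k) *: G).

Definition midpoint X Y : 'rV[R]_2 := 2^-1 *: (X + Y).

Definition point_reflection X U : subspace R := aff_ext (homothety X (-1)) U.

End ExtendedPlane.

Section Triangle.
Variables (R : realType) (A B C : 'rV[R]_2).
Implicit Types P : subspace R.

Definition nondegenerate_triangle : bool := free [:: B - A; C - A].

Definition side (X Y : 'rV[R]_2) : subspace R :=
  line_through (ord_pt X) (ord_pt Y).

Definition off_sides P : Prop :=
  [/\ ~~ on_line P (side B C), ~~ on_line P (side C A)
    & ~~ on_line P (side A B)].

Definition complement_map : affine_map R :=
  homothety (3^-1 *: (A + B + C)) (- 2^-1).

(* The point XP . YZ *)
Definition cevian_foot P (X Y Z : 'rV[R]_2) : subspace R :=
  (line_through (ord_pt X) P :&: side Y Z)%VS.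

Definition footD P : subspace R := cevian_foot P A B C.
Definition footE P : subspace R := cevian_foot P B C A.
Definition footF P : subspace R := cevian_foot P C A B.

Definition footD3 P : subspace R := point_reflection (midpoint B C) (footD P).
Definition footE3 P : subspace R := point_reflection (midpoint C A) (footE P).
Definition footF3 P : subspace R := point_reflection (midpoint A B) (footF P).

Definition isotomic_conjugate P : subspace R :=
  (line_through (ord_pt A) (footD3 P) :&:
   line_through (ord_pt B) (footE3 P) :&:
   line_through (ord_pt C) (footF3 P))%VS.

Definition isotomcomplement P : subspace R :=
  aff_ext complement_map (isotomic_conjugate P).

Definition maps_to_cevian_triangle P (T : affine_map R) : Prop :=
  [/\ ord_pt (aff_app T A) = footD P, ord_pt (aff_app T B) = footE P
    & ord_pt (aff_app T C) = footF P].

Definition is_gen_circumcenter P (O : subspace R) : Prop :=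
  let Q := isotomcomplement P in
  [/\ is_point O,
      on_line O (parallel_through (ord_pt (midpoint B C))
                                  (line_through Q (footD P))),
      on_line O (parallel_through (ord_pt (midpoint C A))
                                  (line_through Q (footE P)))
    & on_line O (parallel_through (ord_pt (midpoint A B))
                                  (line_through Q (footF P)))].

Definition is_gen_orthocenter P (H : subspace R) : Prop :=
  let Q := isotomcomplement P in
  [/\ is_point H,
      on_line H (parallel_through (ord_pt A) (line_through Q (footD P))),
      on_line H (parallel_through (ord_pt B) (line_through Q (footE P)))
    & on_line H (parallel_through (ord_pt C) (line_through Q (footF P)))].

End Triangle.

(* Main.v *)
Require Import Defs.
From mathcomp Require Import all_boot all_order all_algebra reals ring.

(* In barycentric coordinates joins and meets are cross products.  For
   P = (p : q : r) one has P' = (qr : rp : pq), Q = (p(q+r) : q(r+p) : r(p+q)),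
   and with S = pq + qr + rp the point T_{P'}^{-1} K(Q) is
   ((q+r)p(pqr + S(q+r-p)) : ...), which satisfies the equations of the three
   lines defining O.  These lines may coincide in pairs but not all three,
   so O is unique.  Since K fixes the points at
   infinity and sends A, B, C to D_0, E_0, F_0, it sends H to O. *)

Set Implicit Arguments.
Unset Strict Implicit.
Unset Printing Implicit Defensive.

Import GRing.Theory Num.Theory.
Local Open Scope ring_scope.

(** * Affine maps on the projective plane; homotheties and parallels *)

Section AffineMaps.
Variable R : realType.
Implicit Types (X Y : 'rV[R]_2) (T : affine_map R) (U V : subspace R).

(** This is the matrix used inside [aff_ext]; naming it turns composition of affine maps into matrix
    products. *)
Definition aff_mx T : 'M[R]_(2 + 1) := block_mx (aff_lin T) 0 (aff_trans T) 1%:M.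

Lemma lift_aff_app T X : row_mx X 1%:M *m aff_mx T = row_mx (aff_app T X) 1%:M.
Proof. by rewrite mul_row_block !mul1mx mulmx0 add0r. Qed.

Lemma aff_ext_vline T (v : 'rV[R]_(2 + 1)) : aff_ext T <[v]>%VS = <[v *m aff_mx T]>%VS.
Proof. by rewrite /aff_ext limg_line lfunE. Qed.

Lemma aff_ext_ord_pt T X : aff_ext T (ord_pt X) = ord_pt (aff_app T X).
Proof. by rewrite aff_ext_vline lift_aff_app. Qed.

Lemma aff_mx_inv T : aff_invertible T -> aff_mx T *m aff_mx (aff_inv T) = 1%:M.
Proof.
move=> uT; rewrite mulmx_block !mulmx0 !mul0mx !mulmx1 !mul1mx !addr0 add0r.
by rewrite mulmxV // subrr -scalar_mx_block.
Qed.

(** Stated through matrices, so that one product identity gives both cancellation laws below, the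
    second by [mulmx1C]. *)
Lemma aff_ext_comp T1 T2 U : aff_mx T1 *m aff_mx T2 = 1%:M ->
  aff_ext T2 (aff_ext T1 U) = U.
Proof.
move=> T12; rewrite /aff_ext -limg_comp -[RHS](lim1g U); congr (_ @: _)%VS.
by apply/lfunP=> v; rewrite comp_lfunE id_lfunE !lfunE /= -mulmxA T12 mulmx1.
Qed.

Lemma aff_extK T : aff_invertible T -> cancel (aff_ext T) (aff_ext (aff_inv T)).
Proof. by move=> uT U; apply/aff_ext_comp/aff_mx_inv. Qed.

Lemma aff_extVK T : aff_invertible T -> cancel (aff_ext (aff_inv T)) (aff_ext T).
Proof. by move=> uT U; apply/aff_ext_comp/mulmx1C/aff_mx_inv. Qed.

Lemma aff_ext_on_line T U V : aff_invertible T ->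
  on_line (aff_ext T U) (aff_ext T V) = on_line U V.
Proof.
move=> uT; apply/idP/idP; last exact: limgS.
by move/(limgS (linfun (mulmxr (aff_mx (aff_inv T)))));
  rewrite /on_line -!/(aff_ext _ _) !aff_extK.
Qed.

Lemma aff_ext_is_point T U : aff_invertible T -> is_point (aff_ext T U) = is_point U.
Proof.
move=> uT; rewrite /is_point /aff_ext limg_dim_eq //; apply/eqP.
rewrite -subv0; apply/subvP=> v /[!memv_cap] /andP[_]; rewrite memv_ker lfunE /=.
move=> /eqP vT; rewrite memv0 -[v]mulmx1 -(aff_mx_inv uT) mulmxA.
by rewrite [v *m _]vT mul0mx.
Qed.

Lemma aff_invertible_homothety G (k : R) : k != 0 -> aff_invertible (homothety G k).
Proof. by move=> k0; rewrite /aff_invertible unitmxE det_scalar unitfE expf_neq0. Qed.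

Lemma line_at_infinityE X (w : R) :
  (row_mx X w%:M \in line_at_infinity R) = (w == 0).
Proof.
rewrite memv_ker lfunE /= row_mxKr; apply/eqP/eqP => [/matrixP/(_ 0 0)|->].
  by rewrite !mxE mulr1n.
by rewrite raddf0.
Qed.

Lemma lift_decomp (v : 'rV[R]_(2 + 1)) : exists X w, v = row_mx X w%:M.
Proof.
exists (lsubmx v), (rsubmx v 0 0); rewrite -[LHS]hsubmxK; congr row_mx.
exact: mx11_scalar.
Qed.

(* A homothety acts as a scalar on the vectors of the line at infinity. *)
Lemma homothety_infinity G (k : R) U : k != 0 -> (U <= line_at_infinity R)%VS ->
  aff_ext (homothety G k) U = U.
Proof.
move=> k0 /subvP Uinf.
have kU v : v \in U -> linfun (mulmxr (aff_mx (homothety G k))) v = k *: v.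
  move=> /Uinf; have [X [w ->]] := lift_decomp v; rewrite line_at_infinityE => /eqP->.
  by rewrite lfunE /= mul_row_block raddf0 !mul0mx !addr0 mulmx0 mul_mx_scalar
             scale_row_mx scaler0.
apply/vspaceP=> v; apply/memv_imgP/idP => [[u uU ->]|vU].
  by rewrite kU // rpredZ.
have kvU : k^-1 *: v \in U by rewrite rpredZ.
by exists (k^-1 *: v) => //; rewrite kU // scalerA divff // scale1r.
Qed.

(** The part of [V] at infinity is fixed by the homothety and images respect sums, so only [U]
    moves. *)
Lemma homothety_parallel G (k : R) U V : k != 0 ->
  aff_ext (homothety G k) (parallel_through U V) =
  parallel_through (aff_ext (homothety G k) U) V.
Proof.
move=> k0; rewrite /parallel_through /line_through -[in RHS](homothety_infinity G
  k0 (capvSr V _)).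
exact: limgD.
Qed.

(** Two proportional vectors with last coordinate 1 have ratio 1. *)
Lemma ord_pt_inj : injective (@ord_pt R).
Proof.
move=> X Y XY; have /vlineP[k] : row_mx X 1%:M \in ord_pt Y by rewrite -XY memv_line.
rewrite scale_row_mx => /eq_row_mx[-> /matrixP/(_ 0 0)].
by rewrite !mxE !mulr1n mulr1 => <-; rewrite scale1r.
Qed.

Lemma is_point_vline U : is_point U -> exists v, U = <[v]>%VS.
Proof.
move=> /eqP dU; exists (vpick U); apply/eqP; rewrite eq_sym eqEdim -memvE memv_pick.
by rewrite dU dim_vline vpick0 -dimv_eq0 dU.
Qed.
End AffineMaps.

(** * Barycentric coordinates, joins and meets *)

Section Barycentric.
Variables (R : realType) (A B C : 'rV[R]_2).
Implicit Types (x y z l m n : R) (U V L : subspace R).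

(** The coordinates are not normalised: their sum is the last coordinate of the vector, so sum 0
    means a vector at infinity. *)
Definition bary x y z : 'rV[R]_(2 + 1) :=
  x *: row_mx A 1%:M + y *: row_mx B 1%:M + z *: row_mx C 1%:M.

Definition bpt x y z : subspace R := <[bary x y z]>%VS.

(** The zero triple is allowed here; the lemmas on joins, meets and parallels carry their own
    nonvanishing conditions. *)
Definition has_equation L l m n : Prop :=
  forall x y z, (bary x y z \in L) = (l * x + m * y + n * z == 0).

Lemma baryE x y z :
  bary x y z = row_mx (x *: A + y *: B + z *: C) (x + y + z)%:M.
Proof.
by rewrite /bary !scale_row_mx !add_row_mx !scale_scalar_mx !mulr1 -!raddfD.
Qed.

Lemma baryZ k x y z : k *: bary x y z = bary (k * x) (k * y) (k * z).
Proof. by rewrite /bary !scalerDr !scalerA. Qed.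

Lemma baryD x1 y1 z1 x2 y2 z2 :
  bary x1 y1 z1 + bary x2 y2 z2 = bary (x1 + x2) (y1 + y2) (z1 + z2).
Proof. by apply/rowP=> i; rewrite !mxE; ring. Qed.

Lemma lift_bary x y z : x + y + z = 1 ->
  row_mx (x *: A + y *: B + z *: C) 1%:M = bary x y z.
Proof. by move=> <-; rewrite baryE. Qed.

Lemma bary_infinity x y z :
  (bary x y z \in line_at_infinity R) = (x + y + z == 0).
Proof. by rewrite baryE line_at_infinityE. Qed.

Lemma bary_aff_mx (T : affine_map R) x y z : bary x y z *m aff_mx T =
  x *: row_mx (aff_app T A) 1%:M + y *: row_mx (aff_app T B) 1%:M
    + z *: row_mx (aff_app T C) 1%:M.
Proof. by rewrite /bary !mulmxDl -!scalemxAl !lift_aff_app. Qed.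

Lemma ord_ptA : ord_pt A = bpt 1 0 0.
Proof. by rewrite /bpt /bary scale1r !scale0r !addr0. Qed.

Lemma bptZ k x y z : k != 0 -> bpt (k * x) (k * y) (k * z) = bpt x y z.
Proof.
move=> k0; rewrite /bpt -baryZ; apply/vspaceP=> v.
apply/vlineP/vlineP => [] [j ->]; first by exists (j * k); rewrite scalerA.
by exists (j / k); rewrite scalerA divfK.
Qed.

Lemma on_line_bpt L l m n x y z : has_equation L l m n ->
  on_line (bpt x y z) L = (l * x + m * y + n * z == 0).
Proof. by move=> <-. Qed.

Hypothesis hABC : nondegenerate_triangle A B C.

Lemma nondegenerate_coords y z :
  y *: (B - A) + z *: (C - A) = 0 -> (y = 0) /\ (z = 0).
Proof.
move=> yz0; have /freeP/(_ (fun i => [:: y; z]`_i)) : free [tuple B - A; C - A] by [].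
rewrite !big_ord_recl big_ord0 /= addr0 => /(_ yz0) k0.
by split; [exact: (k0 0) | exact: (k0 1)].
Qed.

Lemma plane_coords (X : 'rV[R]_2) : exists y z, X = y *: (B - A) + z *: (C - A).
Proof.
have : X \in <<[:: B - A; C - A]>>%VS.
  have /andP[/eqP-> _] : basis_of fullv [:: B - A; C - A].
    by rewrite basisEfree subvf (idP hABC : free _ = true) dimvf /dim /= mul1n.
  exact: memvf.
rewrite span_cons span_seq1 => /memv_addP[_ /vlineP[y ->] [_ /vlineP[z ->] ->]].
by exists y, z.
Qed.

Lemma bary_surj v : exists x y z, v = bary x y z.
Proof.
have [X [w ->]] := lift_decomp v; have [y [z XE]] := plane_coords (X - w *: A).
(* The weight of [A] is chosen to make the coordinate sum equal to [w]. *)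
exists (w - y - z), y, z; rewrite baryE; congr row_mx; last by congr (_%:M); ring.
by rewrite -[X](subrK (w *: A)) XE; apply/rowP=> i; rewrite !mxE; ring.
Qed.

Lemma bary_eq0 x y z : bary x y z = 0 -> [/\ x = 0, y = 0 & z = 0].
Proof.
rewrite baryE -row_mx0 => /eq_row_mx[XE /matrixP/(_ 0 0)]; rewrite !mxE mulr1n => w0.
have xE : x = - y - z by rewrite -[LHS]subr0 -w0; ring.
have [] := @nondegenerate_coords y z.
  by rewrite -XE xE; apply/rowP=> i; rewrite !mxE; ring.
by move=> y0 z0; rewrite xE y0 z0 oppr0 addr0.
Qed.

Lemma bary_inj x1 y1 z1 x2 y2 z2 :
  bary x1 y1 z1 = bary x2 y2 z2 -> [/\ x1 = x2, y1 = y2 & z1 = z2].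
Proof.
move=> E; have : bary (x1 - x2) (y1 - y2) (z1 - z2) = 0.
  transitivity (bary x1 y1 z1 - bary x2 y2 z2); last by rewrite E subrr.
  by apply/rowP=> i; rewrite !mxE; ring.
by case/bary_eq0 => /subr0_eq-> /subr0_eq-> /subr0_eq->.
Qed.

Lemma bpt_is_point x y z : is_point (bpt x y z) = [|| x != 0, y != 0 | z != 0].
Proof.
rewrite /is_point dim_vline eqb1 -!negb_and; congr negb.
apply/eqP/and3P => [/bary_eq0[-> -> ->]|[/eqP-> /eqP-> /eqP->]] //.
by rewrite /bary !scale0r !addr0.
Qed.

Lemma bpt_surj U : is_point U -> exists x y z, U = bpt x y z.
Proof.
move=> /is_point_vline[v ->]; have [x [y [z ->]]] := bary_surj v.
by exists x, y, z.
Qed.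

(* Joins and meets are cross products of homogeneous coordinates. *)
Lemma join_equation x1 y1 z1 x2 y2 z2 l m n :
    l = y1 * z2 - z1 * y2 -> m = z1 * x2 - x1 * z2 -> n = x1 * y2 - y1 * x2 ->
    [|| l != 0, m != 0 | n != 0] ->
  has_equation (line_through (bpt x1 y1 z1) (bpt x2 y2 z2)) l m n.
Proof.
move=> lE mE nE lmn x y z; apply/memv_addP/eqP => [|eq0].
  move=> [_ /vlineP[s ->] [_ /vlineP[t ->]]]; rewrite !baryZ baryD.
  by case/bary_inj => -> -> ->; rewrite lE mE nE; ring.
suff [s [t [-> -> ->]]] : exists s t,
    [/\ x = s * x1 + t * x2, y = s * y1 + t * y2 & z = s * z1 + t * z2].
  exists (s *: bary x1 y1 z1); first by rewrite memvZ ?memv_line.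
  exists (t *: bary x2 y2 z2); first by rewrite memvZ ?memv_line.
  by rewrite !baryZ baryD.
(* Cramer's rule: the nonzero minor determines [s] and [t] from two coordinates, and [eq0] gives the
   remaining one. *)
case/or3P: lmn => [l0|m0|n0].
- exists ((y * z2 - z * y2) / l), ((y1 * z - z1 * y) / l).
  have -> : x = - (m * y + n * z) / l.
    by apply: (mulIf l0); rewrite divfK // -[RHS]add0r -eq0; ring.
  by move: l0; rewrite mE nE lE => l0; split; field.
- exists ((z * x2 - x * z2) / m), ((z1 * x - x1 * z) / m).
  have -> : y = - (l * x + n * z) / m.
    by apply: (mulIf m0); rewrite divfK // -[RHS]add0r -eq0; ring.
  by move: m0; rewrite lE nE mE => m0; split; field.
exists ((x * y2 - y * x2) / n), ((x1 * y - y1 * x) / n).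
have -> : z = - (l * x + m * y) / n.
  by apply: (mulIf n0); rewrite divfK // -[RHS]add0r -eq0; ring.
by move: n0; rewrite lE mE nE => n0; split; field.
Qed.

Lemma meet_bpt L1 L2 l1 m1 n1 l2 m2 n2 x y z :
    has_equation L1 l1 m1 n1 -> has_equation L2 l2 m2 n2 ->
    x = m1 * n2 - n1 * m2 -> y = n1 * l2 - l1 * n2 -> z = l1 * m2 - m1 * l2 ->
    [|| x != 0, y != 0 | z != 0] ->
  (L1 :&: L2)%VS = bpt x y z.
Proof.
move=> eq1 eq2 xE yE zE xyz; apply/vspaceP=> v; have [a [b [c ->]]] := bary_surj v.
rewrite memv_cap eq1 eq2; apply/andP/vlineP => [[/eqP e1 /eqP e2]|[k]]; last first.
  rewrite baryZ => /bary_inj[-> -> ->]; rewrite xE yE zE.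
  by split; apply/eqP; ring.
(* With v = (a, b, c), the identity v x (L1 x L2) = (v.L2) L1 - (v.L1) L2 shows that v is
   proportional to (x, y, z); the three equalities are its components. *)
have xy : a * y = b * x.
  apply: subr0_eq; transitivity (n1 * (l2 * a + m2 * b + n2 * c) - n2 * (l1 * a +
    m1 * b + n1 * c)).
    by rewrite xE yE; ring.
  by rewrite e1 e2 !mulr0 subr0.
have yz : b * z = c * y.
  apply: subr0_eq; transitivity (l1 * (l2 * a + m2 * b + n2 * c) - l2 * (l1 * a +
    m1 * b + n1 * c)).
    by rewrite yE zE; ring.
  by rewrite e1 e2 !mulr0 subr0.
have zx : c * x = a * z.
  apply: subr0_eq; transitivity (m1 * (l2 * a + m2 * b + n2 * c) - m2 * (l1 * a +
    m1 * b + n1 * c)).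
    by rewrite zE xE; ring.
  by rewrite e1 e2 !mulr0 subr0.
case/or3P: xyz => [x0|y0|z0]; [exists (a / x) | exists (b / y) | exists (c / z)].
- by rewrite baryZ divfK // !(mulrAC _ x^-1) xy -zx !mulfK.
- by rewrite baryZ divfK // !(mulrAC _ y^-1) yz -xy !mulfK.
- by rewrite baryZ divfK // !(mulrAC _ z^-1) zx -yz !mulfK.
Qed.

(** A nonzero cross product makes the intersection one-dimensional, so a point contained in it is
    equal to it. *)
Lemma meet_unique L1 L2 l1 m1 n1 l2 m2 n2 U V :
    has_equation L1 l1 m1 n1 -> has_equation L2 l2 m2 n2 ->
    [|| m1 * n2 - n1 * m2 != 0, n1 * l2 - l1 * n2 != 0 | l1 * m2 - m1 * l2 != 0] ->
    is_point U -> is_point V -> on_line U L1 -> on_line U L2 ->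
    on_line V L1 -> on_line V L2 -> U = V.
Proof.
move=> eq1 eq2 ne pU pV U1 U2 V1 V2.
have W := meet_bpt eq1 eq2 erefl erefl erefl ne.
suff E X : is_point X -> on_line X L1 -> on_line X L2 -> X = (L1 :&: L2)%VS.
  by rewrite (E _ pU U1 U2) (E _ pV V1 V2).
move=> /eqP dX X1 X2; apply/eqP; rewrite eqEdim subv_cap W dX.
by move: X1 X2; rewrite /on_line => -> ->; rewrite dim_vline leq_b1.
Qed.

(** The line at infinity has coefficients (1, 1, 1), so (d1, d2, d3) is the point at infinity of
    [L]. The two conditions say that this point is well defined and that it differs from the given
    point. *)
Lemma parallel_equation x y z L l m n :
    has_equation L l m n ->
  let d1 := m - n in let d2 := n - l in let d3 := l - m in
    [|| d1 != 0, d2 != 0 | d3 != 0] ->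
    [|| y * d3 - z * d2 != 0, z * d1 - x * d3 != 0 | x * d2 - y * d1 != 0] ->
  has_equation (parallel_through (bpt x y z) L)
    (y * d3 - z * d2) (z * d1 - x * d3) (x * d2 - y * d1).
Proof.
move=> eqL d1 d2 d3 d0 j0; rewrite /parallel_through.
rewrite (@meet_bpt _ _ _ _ _ 1 1 1 d1 d2 d3 eqL) ?mulr1 //.
  exact: join_equation.
by move=> ? ? ?; rewrite bary_infinity !mul1r.
Qed.

End Barycentric.

(** * Cyclic relabelling of the triangle, and nondegeneracy *)

Section Cyclic.
Variables (R : realType) (A B C : 'rV[R]_2).

(** Rotating vertices and weights together changes nothing; this lets each computation at [A] serve
    for [B] and [C]. *)
Lemma bary_cycle (x y z : R) : bary B C A y z x = bary A B C x y z.
Proof. by apply/rowP=> i; rewrite !mxE; ring. Qed.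

Lemma bpt_cycle (x y z : R) : bpt B C A y z x = bpt A B C x y z.
Proof. by rewrite /bpt bary_cycle. Qed.

Lemma has_equation_cycle L (l m n : R) :
  has_equation B C A L m n l -> has_equation A B C L l m n.
Proof. by move=> eqL x y z; rewrite -bary_cycle eqL addrC addrA. Qed.

(** A converse of [bary_eq0], by which nondegeneracy passes to the relabelled triangles and to the
    cevian triangle. *)
Lemma bary_free_nondegenerate :
  (forall x y z : R, bary A B C x y z = 0 -> y = 0 /\ z = 0) ->
  nondegenerate_triangle A B C.
Proof.
move=> free0; suff: free [tuple B - A; C - A] by [].
apply/freeP=> k; rewrite !big_ord_recl big_ord0 /= addr0 => k0.
(* The first weight makes the sum 0, so that the combination involves only the edge vectors. *)
have [|kB kC] := free0 (- (k 0 + k 1)) (k 0) (k 1).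
  rewrite baryE -row_mx0; congr row_mx; last by rewrite (_ : _ + _ = 0) ?raddf0 //;
    ring.
  rewrite -[RHS]k0 (_ : lift ord0 ord0 = 1); last exact/val_inj.
  by apply/rowP=> i; rewrite !mxE; ring.
by case=> [[|[|]]] //= i2; [rewrite -[RHS]kB | rewrite -[RHS]kC]; congr k;
  apply/val_inj.
Qed.
End Cyclic.

Lemma nondegenerate_cycle (R : realType) (A B C : 'rV[R]_2) :
  nondegenerate_triangle A B C -> nondegenerate_triangle B C A.
Proof.
move=> hABC; apply: bary_free_nondegenerate => x y z.
by rewrite bary_cycle => /(bary_eq0 hABC)[].
Qed.

Lemma edge_mx_unit (R : realType) (A B C : 'rV[R]_2) :
  nondegenerate_triangle A B C -> col_mx (B - A) (C - A) \in unitmx.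
Proof.
move=> hABC; rewrite -row_free_unit; apply: inj_row_free => v.
rewrite -[v]hsubmxK mul_row_col [lsubmx v]mx11_scalar [rsubmx v]mx11_scalar.
by rewrite !mul_scalar_mx => /(nondegenerate_coords hABC)[-> ->];
  rewrite raddf0 row_mx0.
Qed.

(** * The affine map determined by the images of three vertices *)

Section AffineExtension.
Variables (R : realType) (A B C : 'rV[R]_2).
Hypothesis hABC : nondegenerate_triangle A B C.

(** Differences of vertex images eliminate the translations, and the edge matrix is invertible. *)
Lemma affine_map_eq (T1 T2 : affine_map R) :
  aff_app T1 A = aff_app T2 A -> aff_app T1 B = aff_app T2 B ->
  aff_app T1 C = aff_app T2 C -> T1 = T2.
Proof.
case: T1 T2 => [N1 t1] [N2 t2]; rewrite /aff_app /= => eA eB eC.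
have N12 : N1 = N2.
  apply: (can_inj (mulKmx (edge_mx_unit hABC))); rewrite !mul_col_mx !mulmxBl.
  have sub (X Y Z W : 'rV[R]_2) : X + t1 = Y + t2 -> Z + t1 = W + t2 -> X - Z = Y - W.
    by move=> XY ZW; rewrite -[LHS]addr0
      -(subrr t1) addrACA -opprD XY ZW opprD addrACA subrr addr0.
  by rewrite (sub _ _ _ _ eB eA) (sub _ _ _ _ eC eA).
by move: eA; rewrite N12 => /addrI->.
Qed.

Lemma affine_map_exists (D E F : 'rV[R]_2) : exists T : affine_map R,
  [/\ aff_app T A = D, aff_app T B = E, aff_app T C = F
    & nondegenerate_triangle D E F -> aff_invertible T].
Proof.
(* The linear part must carry the edges at [A] to the edges at [D]. *)
pose N := invmx (col_mx (B - A) (C - A)) *m col_mx (E - D) (F - D).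
have: col_mx (B - A) (C - A) *m N = col_mx (E - D) (F - D).
  by rewrite mulKVmx ?edge_mx_unit.
rewrite mul_col_mx !mulmxBl => /eq_col_mx[eB eC].
exists (AffineMap N (D - A *m N)); split; rewrite /aff_app /=.
- by rewrite addrC subrK.
- by rewrite addrCA eB addrC subrK.
- by rewrite addrCA eC addrC subrK.
by move=> hDEF; rewrite /aff_invertible /= unitmx_mul unitmx_inv !edge_mx_unit.
Qed.
End AffineExtension.

(** * Cevians, their feet, and the line through a midpoint parallel to QD *)

Section Cevians.
Variables (R : realType) (A B C : 'rV[R]_2).
Hypothesis hABC : nondegenerate_triangle A B C.
Implicit Types p q r x y z : R.

Lemma side_equation : has_equation A B C (side B C) 1 0 0.
Proof.
rewrite /side (ord_ptA B C A) (ord_ptA C A B) bpt_cycle -[bpt C A B _ _ _]bpt_cycle.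
by apply: join_equation => //; rewrite ?oner_eq0 //; ring.
Qed.

Lemma cevian_equation x y z : [|| y != 0 | z != 0] ->
  has_equation A B C (line_through (ord_pt A) (bpt A B C x y z)) 0 (- z) y.
Proof.
move=> yz; rewrite (ord_ptA A B C); apply: join_equation => //; try ring.
by rewrite oppr_eq0 eqxx /= orbC.
Qed.

Lemma cevian_foot_bpt x y z : y != 0 ->
  cevian_foot (bpt A B C x y z) A B C = bpt A B C 0 y z.
Proof.
move=> y0; rewrite /cevian_foot.
have eqA := @cevian_equation x y z; rewrite y0 in eqA.
by apply: (meet_bpt hABC (eqA isT) side_equation); rewrite ?y0 ?orbT //; ring.
Qed.

Lemma lift_midpoint : row_mx (midpoint B C) 1%:M = bary A B C 0 2^-1 2^-1.
Proof.
rewrite baryE; congr row_mx; last by congr (_%:M); field.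
by apply/rowP=> i; rewrite !mxE; ring.
Qed.

Lemma ord_pt_midpoint : ord_pt (midpoint B C) = bpt A B C 0 1 1.
Proof.
have k0 : (2^-1 : R) != 0 by rewrite invr_eq0 pnatr_eq0.
by rewrite /ord_pt lift_midpoint -(bptZ A B C 0 1 1 k0) mulr0 mulr1.
Qed.

(** Reflection in the midpoint exchanges [B] and [C], hence their weights; this turns D into D_3. *)
Lemma reflection_bpt y z :
  point_reflection (midpoint B C) (bpt A B C 0 y z) = bpt A B C 0 z y.
Proof.
rewrite /point_reflection aff_ext_vline bary_aff_mx; congr <[_]>%VS.
rewrite -/(bary _ _ _ _ _ _) !baryE; congr row_mx; last by congr (_%:M); ring.
rewrite /aff_app /= !mul_mx_scalar /midpoint.
by apply/rowP=> i; rewrite !mxE; field.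
Qed.

Lemma ord_pt_div x y z : x + y + z != 0 ->
  ord_pt ((x / (x + y + z)) *: A + (y / (x + y + z)) *: B + (z / (x + y + z)) *: C)
  = bpt A B C x y z.
Proof.
move=> s0; rewrite /ord_pt lift_bary; last by field.
have := bptZ A B C x y z (invr_neq0 s0); rewrite ![_^-1 * _]mulrC; exact.
Qed.

Lemma circumcenter_line_equation p q r : p != 0 -> q + r != 0 ->
  has_equation A B C
    (parallel_through (ord_pt (midpoint B C))
       (line_through (bpt A B C (p * (q + r)) (q * (p + r)) (r * (p + q)))
                     (bpt A B C 0 q r)))
    ((r - q) * (2 * q * r + p * q + p * r)) (- (p * (q + r) ^+ 2)) (p * (q + r) ^+ 2).
Proof.
move=> p0 qr0; rewrite ord_pt_midpoint.
set L := line_through _ _.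
have d0 : - (p * (q + r) ^+ 2) != 0 by rewrite oppr_eq0 mulf_neq0 ?expf_neq0.
have eqL : has_equation A B C L (q * r * (r - q)) (- (p * r * (q + r))) (p * q * (q
  + r)).
  apply: join_equation => //; try ring.
  (* Since q + r is nonzero, q or r is, and with it one of the last two coefficients. *)
  apply/orP; right; rewrite oppr_eq0 !mulf_eq0 !negb_or p0 qr0 !andbT /= orbC.
  by have [q0|//] := eqVneq q 0; rewrite -[r]add0r -{1}q0.
(* This is the first coordinate of the point at infinity of QD; it is nonzero, which settles both
   conditions of [parallel_equation]. *)
have dE : - (p * r * (q + r)) - p * q * (q + r) = - (p * (q + r) ^+ 2) by ring.
have H := parallel_equation hABC (x := 0) (y := 1) (z := 1) eqL.
move=> x y z; rewrite H; first by congr (_ == 0); ring.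
  by rewrite dE d0.
by rewrite !mul1r !mul0r !subr0 dE d0 orbT.
Qed.
End Cevians.

(** * The complement map on vertices *)

Section Complement.
Variables (R : realType) (A B C : 'rV[R]_2).
Let K := complement_map A B C.

Lemma complement_map_cycle : complement_map B C A = K.
Proof. by rewrite /K /complement_map [B + C + A]addrC addrA. Qed.

Lemma complement_vertex : aff_app K A = midpoint B C.
Proof.
rewrite /aff_app /= mul_mx_scalar /midpoint.
by apply/rowP=> i; rewrite !mxE; field.
Qed.

Lemma complement_invertible : aff_invertible K.
Proof. by apply: aff_invertible_homothety; rewrite oppr_eq0 invr_eq0 pnatr_eq0. Qed.

Lemma anticomplement_vertex : aff_app (aff_inv K) A = B + C - A.
Proof.
rewrite /aff_app /= invmx_scalar !mul_mx_scalar.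
by apply/rowP=> i; rewrite !mxE; field.
Qed.

Lemma ord_pt_anticomplement_vertex :
  ord_pt (aff_app (aff_inv K) A) = bpt A B C (-1) 1 1.
Proof.
rewrite anticomplement_vertex /ord_pt /bpt baryE; congr <[row_mx _ _%:M]>%VS;
  last by ring.
by apply/rowP=> i; rewrite !mxE; ring.
Qed.
End Complement.

(** * The anticomplementary sides, the complement map in coordinates, and the isotomic conjugate *)

Section Isotomic.
Variables (R : realType) (A B C : 'rV[R]_2).
Hypothesis hABC : nondegenerate_triangle A B C.
Let K := complement_map A B C.
Implicit Types p q r x y z : R.

(** The cross product of (1 : -1 : 1) and (1 : 1 : -1). Avoiding the anticomplementary sides thus
    means that q + r, r + p, p + q are nonzero. *)
Lemma anticomplementary_side_equation :
  has_equation A B C (side (aff_app (aff_inv K) B) (aff_app (aff_inv K) C)) 0 2 2.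
Proof.
have eB := ord_pt_anticomplement_vertex B C A.
have eC := ord_pt_anticomplement_vertex C A B.
rewrite (complement_map_cycle A B C) (bpt_cycle A B C) in eB.
rewrite (complement_map_cycle B C A) (complement_map_cycle A B C) in eC.
rewrite (bpt_cycle B C A) (bpt_cycle A B C) in eC.
rewrite /side eB eC; apply: join_equation => //; try ring.
by rewrite pnatr_eq0 orbT.
Qed.

(** Each vertex goes to the opposite midpoint, so its weight is shared equally by the other two
    vertices; the common factor 1/2 is dropped. *)
Lemma complement_bpt x y z :
  aff_ext K (bpt A B C x y z) = bpt A B C (y + z) (z + x) (x + y).
Proof.
have k0 : (2^-1 : R) != 0 by rewrite invr_eq0 pnatr_eq0.
rewrite aff_ext_vline bary_aff_mx -(bptZ A B C _ _ _ k0) /bpt; congr <[_]>%VS.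
have KB := complement_vertex B C A; rewrite (complement_map_cycle A B C) in KB.
have KC := complement_vertex C A B.
rewrite (complement_map_cycle B C A) (complement_map_cycle A B C) in KC.
rewrite complement_vertex KB KC -/(bary _ _ _ _ _ _) !baryE /midpoint.
congr row_mx; last by congr (_%:M); field.
by apply/rowP=> i; rewrite !mxE; field.
Qed.

Lemma cevian3_equation p q r : q != 0 ->
  has_equation A B C (line_through (ord_pt A)
    (point_reflection (midpoint B C) (cevian_foot (bpt A B C p q r) A B C)))
  0 (- q) r.
Proof.
move=> q0; rewrite cevian_foot_bpt // reflection_bpt.
by apply: cevian_equation => //; rewrite q0 orbT.
Qed.

(** The foot D_3 = (0 : r : q) is written as an ordinary point, as needed to define T_{P'} on
    vertices. *)
Lemma cevian_foot_isotomic p q r : p != 0 -> r != 0 -> q + r != 0 ->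
  cevian_foot (bpt A B C (q * r) (r * p) (p * q)) A B C =
  ord_pt ((r / (q + r)) *: B + (q / (q + r)) *: C).
Proof.
move=> p0 r0 qr0; rewrite cevian_foot_bpt ?mulf_neq0 // [r * p]mulrC.
rewrite -{1}(mulr0 p) bptZ // -ord_pt_div add0r ?mul0r ?scale0r ?add0r [r + q]addrC //.
Qed.
End Isotomic.

Lemma isotomic_conjugate_bpt (R : realType) (A B C : 'rV[R]_2) (p q r : R) :
  nondegenerate_triangle A B C -> p != 0 -> q != 0 -> r != 0 ->
  isotomic_conjugate A B C (bpt A B C p q r) = bpt A B C (q * r) (r * p) (p * q).
Proof.
move=> hABC p0 q0 r0; have hBCA := nondegenerate_cycle hABC.
have hCAB := nondegenerate_cycle hBCA.
have eqA := cevian3_equation hABC p r q0.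
have := cevian3_equation hBCA q p r0; rewrite bpt_cycle => /has_equation_cycle eqB.
have := cevian3_equation hCAB r q p0.
rewrite (bpt_cycle B C A) (bpt_cycle A B C) =>
  /has_equation_cycle/has_equation_cycle eqC.
rewrite /isotomic_conjugate /footD3 /footE3 /footF3 /footD /footE /footF.
rewrite (@meet_bpt _ _ _ _ hABC _ _ _ _ _ _ _ _ (q * r) (r * p) (p * q) eqA eqB);
  try ring.
  (* Concurrency: the line CF_3 passes through the meet of AD_3 and BE_3. *)
  apply/capv_idPl; rewrite -[(_ <= _)%VS]/(on_line _ _) (on_line_bpt _ _ _ eqC).
  by apply/eqP; ring.
by rewrite mulf_neq0.
Qed.

(** * The generalized circumcenter and the map T_{P'} *)

Section Circumcenter.
Variables (R : realType) (A B C : 'rV[R]_2) (p q r : R).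
Hypothesis hABC : nondegenerate_triangle A B C.
Hypotheses (p0 : p != 0) (q0 : q != 0) (r0 : r != 0).
Hypotheses (qr0 : q + r != 0) (rp0 : r + p != 0) (pq0 : p + q != 0).
Let K := complement_map A B C.
Let P := bpt A B C p q r.
Let P' := isotomic_conjugate A B C P.
Let Q := isotomcomplement A B C P.

Let hBCA := nondegenerate_cycle hABC.
Let hCAB := nondegenerate_cycle hBCA.

Lemma isotomcomplement_bpt : Q = bpt A B C (p * (q + r)) (q * (p + r)) (r * (p + q)).
Proof.
rewrite /Q /isotomcomplement isotomic_conjugate_bpt // complement_bpt.
by congr bpt; ring.
Qed.

Lemma circumcenter_lines : [/\
    has_equation A B C
      (parallel_through (ord_pt (midpoint B C)) (line_through Q (footD A B C P)))
      ((r - q) * (2 * q * r + p * q + p * r)) (- (p * (q + r) ^+ 2)) (p * (q + r) ^+ 2),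
    has_equation A B C
      (parallel_through (ord_pt (midpoint C A)) (line_through Q (footE A B C P)))
      (q * (r + p) ^+ 2) ((p - r) * (2 * r * p + q * r + q * p)) (- (q * (r + p) ^+ 2))
  & has_equation A B C
      (parallel_through (ord_pt (midpoint A B)) (line_through Q (footF A B C P)))
      (- (r * (p + q) ^+ 2)) (r * (p + q) ^+ 2) ((q - p) * (2 * p * q + r * p + r *
        q))].
Proof.
(* P and Q keep the same shape in the relabelled triangles, so the computation at D applies to E and
   F. *)
have PB : P = bpt B C A q r p by rewrite (bpt_cycle A B C).
have PC : P = bpt C A B r p q by rewrite (bpt_cycle B C A) (bpt_cycle A B C).
have QB : Q = bpt B C A (q * (r + p)) (r * (q + p)) (p * (q + r)).
  by rewrite isotomcomplement_bpt (bpt_cycle A B C); congr bpt; ring.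
have QC : Q = bpt C A B (r * (p + q)) (p * (r + q)) (q * (r + p)).
  by rewrite isotomcomplement_bpt (bpt_cycle B C A) (bpt_cycle A B C); congr bpt; ring.
split.
- rewrite /footD isotomcomplement_bpt cevian_foot_bpt //.
  exact: circumcenter_line_equation.
- rewrite /footE QB PB cevian_foot_bpt //; apply: has_equation_cycle.
  exact: circumcenter_line_equation.
rewrite /footF QC PC cevian_foot_bpt //; do 2!apply: has_equation_cycle.
exact: circumcenter_line_equation.
Qed.

Lemma gen_circumcenter_unique (U V : subspace R) :
  is_gen_circumcenter A B C P U -> is_gen_circumcenter A B C P V -> U = V.
Proof.
case=> pU UA UB UC [pV VA VB VC]; have [eqA eqB eqC] := circumcenter_lines.
have dA : p * (q + r) ^+ 2 != 0 by rewrite mulf_neq0 ?expf_neq0.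
have dB : q * (r + p) ^+ 2 != 0 by rewrite mulf_neq0 ?expf_neq0.
have dC : r * (p + q) ^+ 2 != 0 by rewrite mulf_neq0 ?expf_neq0.
move: eqA eqB eqC; set a := (r - q) * _; set d := p * _ in dA *.
set e := q * _ in dB *; set f := r * _ in dC * => eqA eqB eqC.
have [ad|ad] := eqVneq (a + d) 0.
  apply: (meet_unique hABC eqA eqC) => //; apply/or3P/Or33.
  rewrite (_ : _ - _ = - (f * (d *+ 2))) ?oppr_eq0 ?mulf_neq0 ?mulrn_eq0 //.
  by move/eqP: ad; rewrite addr_eq0 => /eqP->; ring.
apply: (meet_unique hABC eqA eqB) => //; apply/or3P/Or32.
by rewrite (_ : _ - _ = e * (a + d)) ?mulf_neq0 //; ring.
Qed.

Let S := p * q + q * r + r * p.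
Let O := bpt A B C ((q + r) * p * (p * q * r + S * (q + r - p)))
                   ((r + p) * q * (p * q * r + S * (r + p - q)))
                   ((p + q) * r * (p * q * r + S * (p + q - r))).

(** That the triple of [O] is not zero is left as a premise; it is obtained later from T(O) =
    K(Q). *)
Lemma bpt_gen_circumcenter : is_point O -> is_gen_circumcenter A B C P O.
Proof.
move=> pO; have [eqA eqB eqC] := circumcenter_lines.
split=> //; rewrite (on_line_bpt _ _ _ eqA, on_line_bpt _ _ _ eqB, on_line_bpt _ _
  _ eqC);
  by apply/eqP; rewrite /S; ring.
Qed.

Lemma isotomcomplement_is_point : is_point Q.
Proof. by rewrite isotomcomplement_bpt bpt_is_point // mulf_neq0. Qed.

(** Checking T(O) = K(Q) avoids computing the inverse of T. *)
Lemma cevian_map_exists : exists T : affine_map R,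
  [/\ unique (maps_to_cevian_triangle A B C P') T, aff_invertible T
    & aff_ext T O = aff_ext K Q].
Proof.
pose D := (r / (q + r)) *: B + (q / (q + r)) *: C.
pose E := (p / (r + p)) *: C + (r / (r + p)) *: A.
pose F := (q / (p + q)) *: A + (p / (p + q)) *: B.
have P'E : P' = bpt A B C (q * r) (r * p) (p * q) by exact: isotomic_conjugate_bpt.
have hD : footD A B C P' = ord_pt D.
  by rewrite /footD P'E cevian_foot_isotomic.
have hE : footE A B C P' = ord_pt E.
  by rewrite /footE P'E -(bpt_cycle A B C) cevian_foot_isotomic.
have hF : footF A B C P' = ord_pt F.
  by rewrite /footF P'E -(bpt_cycle A B C) -(bpt_cycle B C A) cevian_foot_isotomic.
(* Change of coordinates from the triangle D_3E_3F_3 to ABC, which is also the action of T on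
   weights. *)
have DEF (x y z : R) : bary D E F x y z =
    bary A B C (y * r / (r + p) + z * q / (p + q))
               (x * r / (q + r) + z * p / (p + q))
               (x * q / (q + r) + y * p / (r + p)).
  rewrite !baryE; congr row_mx; last by congr (_%:M); field; do ?[apply/andP; split].
  by apply/rowP=> i; rewrite !mxE; field; do ?[apply/andP; split].
have [T [TA TB TC invT]] := affine_map_exists hABC D E F.
exists T; split.
- split; first by rewrite /maps_to_cevian_triangle TA TB TC hD hE hF.
  rewrite /maps_to_cevian_triangle hD hE hF => T' [T'A T'B T'C].
  by apply: (affine_map_eq hABC); [rewrite TA | rewrite TB | rewrite TC];
    apply: ord_pt_inj.
- apply/invT/bary_free_nondegenerate => x y z;
  rewrite DEF => /(bary_eq0 hABC)[e1 e2 e3].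
  have z0 : z = 0.
    have k0 : 2 * p * q / (p + q) != 0 by rewrite !mulf_neq0 ?invr_eq0 ?pnatr_eq0.
    apply: (mulIf k0); rewrite mul0r.
    (* In this combination of the three vanishing coordinates the terms in x and y cancel, leaving
       2pqz / (p + q). *)
    transitivity (p * (y * r / (r + p) + z * q / (p + q))
      + q * (x * r / (q + r) + z * p / (p + q)) - r * (x * q / (q + r) + y * p / (r
        + p))).
      by field; do ?[apply/andP; split].
    by rewrite e1 e2 e3 !mulr0 subr0 addr0.
  split=> //; have k0 : r / (r + p) != 0 by rewrite mulf_neq0 ?invr_eq0.
  by apply: (mulIf k0); rewrite mul0r mulrA -[RHS]e1 z0 !mul0r addr0.
(* T sends the chosen vector of [O] to 2pqr times that of K(Q); for instance the first coordinate
   becomes 2pqr(qr + S). *)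
have k0 : 2 * p * q * r != 0 by rewrite !mulf_neq0 ?pnatr_eq0.
rewrite isotomcomplement_bpt complement_bpt -(bptZ _ _ _ _ _ _ k0) aff_ext_vline.
rewrite bary_aff_mx TA TB TC -/(bary _ _ _ _ _ _) DEF /bpt /S.
by congr <[bary _ _ _ _ _ _]>%VS; field; do ?[apply/andP; split].
Qed.
End Circumcenter.

(** * Passage to the orthocenter, and the conclusion *)

Lemma gen_orthocenter_complement (R : realType) (A B C : 'rV[R]_2) (P H : subspace R) :
  is_gen_orthocenter A B C P H <->
  is_gen_circumcenter A B C P (aff_ext (complement_map A B C) H).
Proof.
have invK := complement_invertible A B C.
have k0 : - 2^-1 != 0 :> R by rewrite oppr_eq0 invr_eq0 pnatr_eq0.
have KA := complement_vertex A B C.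
have KB := complement_vertex B C A; rewrite (complement_map_cycle A B C) in KB.
have KC := complement_vertex C A B.
rewrite (complement_map_cycle B C A) (complement_map_cycle A B C) in KC.
rewrite /is_gen_circumcenter /is_gen_orthocenter -KA -KB -KC -!aff_ext_ord_pt.
by rewrite -!(homothety_parallel _ _ _ k0) !aff_ext_on_line // aff_ext_is_point.
Qed.

Theorem theorem3p2 (R : realType) (A B C : 'rV[R]_2) (P : subspace R)
    (hABC : nondegenerate_triangle A B C)
    (hP : is_point P)
    (hside : off_sides A B C P)
    (hanti : let K' := aff_inv (complement_map A B C) in
             off_sides (aff_app K' A) (aff_app K' B) (aff_app K' C) P) :
  let K := complement_map A B C in
  let P' := isotomic_conjugate A B C P in
  let Q := aff_ext K P' in
  exists T : affine_map R,
    [/\ unique (maps_to_cevian_triangle A B C P') T,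
        aff_invertible T,
        unique (is_gen_circumcenter A B C P)
          (aff_ext (aff_inv T) (aff_ext K Q))
      & unique (is_gen_orthocenter A B C P)
          (aff_ext (aff_inv K) (aff_ext (aff_inv T) (aff_ext K Q)))].

Proof.
move=> K P' Q.
have [p [q [r PE]]] := bpt_surj hABC hP.
have hBCA := nondegenerate_cycle hABC; have hCAB := nondegenerate_cycle hBCA.
have sideA := side_equation hABC; have antiA := anticomplementary_side_equation hABC.
have sideB := has_equation_cycle (side_equation hBCA).
have antiB := has_equation_cycle (anticomplementary_side_equation hBCA).
have sideC := has_equation_cycle (has_equation_cycle (side_equation hCAB)).
have antiC := has_equation_cycle (has_equation_cycle
  (anticomplementary_side_equation hCAB)).
rewrite (complement_map_cycle B C A) in antiC.
rewrite (complement_map_cycle A B C) in antiB antiC.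
(* The six incidence conditions become: p, q, r and q + r, r + p, p + q are nonzero. *)
move: hside hanti => [] + + + /= []; rewrite PE.
rewrite (on_line_bpt _ _ _ sideA) (on_line_bpt _ _ _ sideB) (on_line_bpt _ _ _ sideC).
rewrite (on_line_bpt _ _ _ antiA) (on_line_bpt _ _ _ antiB) (on_line_bpt _ _ _ antiC).
rewrite !mul0r !mul1r !addr0 !add0r => p0 q0 r0.
rewrite -!mulrDr !mulf_eq0 !pnatr_eq0 /= => qr0; rewrite addrC => rp0 pq0.
have [T [uT invT TO]] := cevian_map_exists hABC p0 q0 r0 qr0 rp0 pq0.
have invK := complement_invertible A B C.
(* With K(Q) replaced by T(O), the inverse of T cancels and the claimed circumcenter is [O]. *)
exists T; rewrite /Q /P' /K {}PE -[aff_ext _ (isotomic_conjugate _ _ _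
  _)]/(isotomcomplement A B C _) -TO.
rewrite aff_extK //.
set P0 := bpt A B C p q r in uT TO *; set O := bpt A B C _ _ _ in TO *.
(* K(Q) is a point and T is invertible, so the explicit coordinates of [O] cannot all vanish. *)
have pO : is_point O.
  by rewrite -(aff_ext_is_point O invT) TO aff_ext_is_point //
    isotomcomplement_is_point.
have circO : is_gen_circumcenter A B C P0 O by exact: bpt_gen_circumcenter.
have unO X : is_gen_circumcenter A B C P0 X -> O = X.
  exact: gen_circumcenter_unique circO.
(* Existence and uniqueness of H follow from those of O, since K is a bijection between the
   solutions. *)
split=> //; split.
  by apply/gen_orthocenter_complement; rewrite aff_extVK.
by move=> X /gen_orthocenter_complement/unO->; rewrite aff_extK.
Qed.
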